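(* There is an effective translation $A\mapsto A^{\circ}$ from the language of $\operatorname{T}_{\mathbb{P}}^{\mathrm{loc}}$ to the language of $\mathsf{HA}$ which replaces $\operatorname{U}$, $\operatorname{P}$ and $\operatorname{C}$ by their defining arithmetic formulas. The local theory proves, for every formula $A$ of its language, $\operatorname{T}_{\mathbb{P}}^{\mathrm{loc}}\vdash A\iff A^{\circ}$. Consequently, for every sentence $\varphi$ in the original language of $\mathsf{HA}$, $\operatorname{T}_{\mathbb{P}}^{\mathrm{loc}}\vdash\varphi$ if and only if $\mathsf{HA}\vdash\varphi$. Moreover, every classical first-order model $\mathcal{M}\models\mathsf{HA}$, under ordinary Tarskian satisfaction, has a unique expansion to the extended language satisfying $\Theta_{\mathrm{U,P,C}}$.
   Context: $\mathsf{HA}$ is Heyting Arithmetic (intuitionistic first-order arithmetic) in a language with $0,1,+,\cdot,=$ and order. The extended language adds three unary predicate symbols $\operatorname{U},\operatorname{P},\operatorname{C}$. Let $R(a,b,n)$ abbreviate the arithmetic formula $a>1\wedge b>1\wedge ab=n$. $\Theta_{\mathrm{U,P,C}}$ is the set of (universally closed) defining clauses $\operatorname{U}(n)\iff n=1$; $\operatorname{C}(n)\iff\exists a,b\le n\,R(a,b,n)$; $\operatorname{P}(n)\iff n>1\wedge\forall a,b\le n\,\neg R(a,b,n)$. The local theory is the definitional extension $\operatorname{T}_{\mathbb{P}}^{\mathrm{loc}}=\mathsf{HA}+\Theta_{\mathrm{U,P,C}}$ (over intuitionistic logic). *)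

(* Defs.v *)
From Stdlib Require Import List.
Import ListNotations.
Set Implicit Arguments.
Unset Strict Implicit.

(** Variables are de Bruijn indices. *)
Inductive tm : Type :=
| Var (n : nat)
| Zero
| One
| Add (s t : tm)
| Mul (s t : tm).

(** Formulas over [0, 1, +, *, =, <] and a type [Q] of further unary
    predicate symbols; the language of HA is the case [Q = Empty_set]. *)
Inductive fm (Q : Type) : Type :=
| Eq (s t : tm)
| Lt (s t : tm)
| Pr (q : Q) (t : tm)
| Bot
| And (A B : fm Q)
| Or (A B : fm Q)
| Imp (A B : fm Q)
| All (A : fm Q)
| Ex (A : fm Q).

Arguments Eq {Q} s t.
Arguments Lt {Q} s t.
Arguments Pr {Q} q t.
Arguments Bot {Q}.

Inductive upc : Type := U | P | C.

Definition Neg Q (A : fm Q) : fm Q := Imp A Bot.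
Definition Iff Q (A B : fm Q) : fm Q := And (Imp A B) (Imp B A).
Definition Le {Q} (s t : tm) : fm Q := Or (Lt s t) (Eq s t).

Fixpoint tsubst (f : nat -> tm) (t : tm) : tm :=
  match t with
  | Var n => f n
  | Zero => Zero
  | One => One
  | Add s t => Add (tsubst f s) (tsubst f t)
  | Mul s t => Mul (tsubst f s) (tsubst f t)
  end.

Definition shift (n : nat) : tm := Var (S n).
Definition lift (t : tm) : tm := tsubst shift t.

Definition up (f : nat -> tm) (n : nat) : tm :=
  match n with 0 => Var 0 | S k => lift (f k) end.

Fixpoint subst Q (f : nat -> tm) (A : fm Q) : fm Q :=
  match A with
  | Eq s t => Eq (tsubst f s) (tsubst f t)
  | Lt s t => Lt (tsubst f s) (tsubst f t)
  | Pr q t => Pr q (tsubst f t)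
  | Bot => Bot
  | And A B => And (subst f A) (subst f B)
  | Or A B => Or (subst f A) (subst f B)
  | Imp A B => Imp (subst f A) (subst f B)
  | All A => All (subst (up f) A)
  | Ex A => Ex (subst (up f) A)
  end.

Definition inst Q (t : tm) (A : fm Q) : fm Q :=
  subst (fun n => match n with 0 => t | S k => Var k end) A.

(** [fv A] is the least [n] such that all free variables of [A] are [< n]. *)
Fixpoint tfv (t : tm) : nat :=
  match t with
  | Var n => S n
  | Zero | One => 0
  | Add s t | Mul s t => Nat.max (tfv s) (tfv t)
  end.

Fixpoint fv Q (A : fm Q) : nat :=
  match A with
  | Eq s t | Lt s t => Nat.max (tfv s) (tfv t)
  | Pr _ t => tfv t
  | Bot => 0
  | And A B | Or A B | Imp A B => Nat.max (fv A) (fv B)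
  | All A | Ex A => Nat.pred (fv A)
  end.

Definition sentence Q (A : fm Q) : Prop := fv A = 0.

Definition closure Q (A : fm Q) : fm Q := Nat.iter (fv A) (@All Q) A.

Fixpoint emb Q (A : fm Empty_set) : fm Q :=
  match A with
  | Eq s t => Eq s t
  | Lt s t => Lt s t
  | Pr q _ => match q with end
  | Bot => Bot
  | And A B => And (emb Q A) (emb Q B)
  | Or A B => Or (emb Q A) (emb Q B)
  | Imp A B => Imp (emb Q A) (emb Q B)
  | All A => All (emb Q A)
  | Ex A => Ex (emb Q A)
  end.

Arguments emb {Q} A.

(** The set [T] of axioms is meant to consist of sentences: [nd_ax] is not
    restricted by the eigenvariable conditions of [nd_allI] and [nd_exE]. *)
Inductive nd Q (T : fm Q -> Prop) : list (fm Q) -> fm Q -> Prop :=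
| nd_ax G A : T A -> nd T G A
| nd_hyp G A : In A G -> nd T G A
| nd_botE G A : nd T G Bot -> nd T G A
| nd_andI G A B : nd T G A -> nd T G B -> nd T G (And A B)
| nd_andE1 G A B : nd T G (And A B) -> nd T G A
| nd_andE2 G A B : nd T G (And A B) -> nd T G B
| nd_orI1 G A B : nd T G A -> nd T G (Or A B)
| nd_orI2 G A B : nd T G B -> nd T G (Or A B)
| nd_orE G A B D :
    nd T G (Or A B) -> nd T (A :: G) D -> nd T (B :: G) D -> nd T G D
| nd_impI G A B : nd T (A :: G) B -> nd T G (Imp A B)
| nd_impE G A B : nd T G (Imp A B) -> nd T G A -> nd T G B
| nd_allI G A : nd T (map (subst shift) G) A -> nd T G (All A)
| nd_allE G A t : nd T G (All A) -> nd T G (inst t A)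
| nd_exI G A t : nd T G (inst t A) -> nd T G (Ex A)
| nd_exE G A D :
    nd T G (Ex A) -> nd T (A :: map (subst shift) G) (subst shift D) ->
    nd T G D
| nd_eqI G t : nd T G (Eq t t)
| nd_eqE G A s t : nd T G (Eq s t) -> nd T G (inst s A) -> nd T G (inst t A).

Definition proves Q (T : fm Q -> Prop) (A : fm Q) : Prop := nd T [] A.

Definition ind_ax (A : fm Empty_set) : fm Empty_set :=
  Imp
    (And (inst Zero A)
         (All (Imp A (subst (fun n => match n with
                                      | 0 => Add (Var 0) One
                                      | S k => Var (S k)
                                      end) A))))
    (All A).

Inductive HA_matrix : fm Empty_set -> Prop :=
| ha_succ0 : HA_matrix (Neg (Eq (Add (Var 0) One) Zero))
| ha_succ_inj :
    HA_matrix (Imp (Eq (Add (Var 0) One) (Add (Var 1) One))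
                   (Eq (Var 0) (Var 1)))
| ha_add0 : HA_matrix (Eq (Add (Var 0) Zero) (Var 0))
| ha_addS :
    HA_matrix (Eq (Add (Var 0) (Add (Var 1) One))
                  (Add (Add (Var 0) (Var 1)) One))
| ha_mul0 : HA_matrix (Eq (Mul (Var 0) Zero) Zero)
| ha_mulS :
    HA_matrix (Eq (Mul (Var 0) (Add (Var 1) One))
                  (Add (Mul (Var 0) (Var 1)) (Var 0)))
| ha_lt :
    HA_matrix (Iff (Lt (Var 0) (Var 1))
                   (Ex (Eq (Add (Var 1) (Add (Var 0) One)) (Var 2))))
| ha_ind A : HA_matrix (ind_ax A).

Definition HA (A : fm Empty_set) : Prop :=
  exists B, HA_matrix B /\ A = closure B.

Definition R {Q} (a b n : tm) : fm Q :=
  And (Lt One a) (And (Lt One b) (Eq (Mul a b) n)).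

Definition AllLe Q (t : tm) (A : fm Q) : fm Q :=
  All (Imp (Le (Var 0) (lift t)) A).
Definition ExLe Q (t : tm) (A : fm Q) : fm Q :=
  Ex (And (Le (Var 0) (lift t)) A).

Definition definiens {Q} (q : upc) (t : tm) : fm Q :=
  match q with
  | U => Eq t One
  | P => And (Lt One t)
           (AllLe t (AllLe (lift t) (Neg (R (Var 1) (Var 0) (lift (lift t))))))
  | C => ExLe t (ExLe (lift t) (R (Var 1) (Var 0) (lift (lift t))))
  end.

Definition Theta (A : fm upc) : Prop :=
  exists q, A = All (Iff (Pr q (Var 0)) (definiens q (Var 0))).

(** The induction schema is that of HA, for arithmetical formulas only. *)
Definition T_loc (A : fm upc) : Prop :=
  (exists B, HA B /\ A = emb B) \/ Theta A.

Record replaces_definitions (tr : fm upc -> fm Empty_set) : Prop := {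
  tr_eq : forall s t, tr (Eq s t) = Eq s t;
  tr_lt : forall s t, tr (Lt s t) = Lt s t;
  tr_pr : forall q t, tr (Pr q t) = definiens q t;
  tr_bot : tr Bot = Bot;
  tr_and : forall A B, tr (And A B) = And (tr A) (tr B);
  tr_or : forall A B, tr (Or A B) = Or (tr A) (tr B);
  tr_imp : forall A B, tr (Imp A B) = Imp (tr A) (tr B);
  tr_all : forall A, tr (All A) = All (tr A);
  tr_ex : forall A, tr (Ex A) = Ex (tr A) }.

Inductive lam : Type :=
| LVar (n : nat)
| LApp (s t : lam)
| LLam (s : lam).

Fixpoint lrename (r : nat -> nat) (s : lam) : lam :=
  match s with
  | LVar n => LVar (r n)
  | LApp s t => LApp (lrename r s) (lrename r t)
  | LLam s =>
      LLam (lrename (fun n => match n with 0 => 0 | S k => S (r k) end) s)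
  end.

Fixpoint lsubst (f : nat -> lam) (s : lam) : lam :=
  match s with
  | LVar n => f n
  | LApp s t => LApp (lsubst f s) (lsubst f t)
  | LLam s =>
      LLam (lsubst (fun n => match n with
                             | 0 => LVar 0
                             | S k => lrename S (f k)
                             end) s)
  end.

Fixpoint lfv (s : lam) : nat :=
  match s with
  | LVar n => S n
  | LApp s t => Nat.max (lfv s) (lfv t)
  | LLam s => Nat.pred (lfv s)
  end.

Inductive lred : lam -> lam -> Prop :=
| lred_beta s t :
    lred (LApp (LLam s) t)
         (lsubst (fun n => match n with 0 => t | S k => LVar k end) s)
| lred_app s s' t t' : lred s s' -> lred t t' -> lred (LApp s t) (LApp s' t')
| lred_lam s s' : lred s s' -> lred (LLam s) (LLam s')
| lred_refl s : lred s s
| lred_trans s t u : lred s t -> lred t u -> lred s u.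

(** "Effective" is rendered as lambda-definability: the translation acts by
    beta-reduction on the Scott codes of formulas.  [scott n i args] is the
    code of the [i]-th of [n] constructors; [args] must be closed. *)
Definition scott (n i : nat) (args : list lam) : lam :=
  Nat.iter n LLam (fold_left LApp args (LVar i)).

Fixpoint enc_nat (n : nat) : lam :=
  match n with
  | 0 => scott 2 0 []
  | S k => scott 2 1 [enc_nat k]
  end.

Fixpoint enc_tm (t : tm) : lam :=
  match t with
  | Var n => scott 5 0 [enc_nat n]
  | Zero => scott 5 1 []
  | One => scott 5 2 []
  | Add s t => scott 5 3 [enc_tm s; enc_tm t]
  | Mul s t => scott 5 4 [enc_tm s; enc_tm t]
  end.

Fixpoint enc_fm Q (enc : Q -> lam) (A : fm Q) : lam :=
  match A with
  | Eq s t => scott 9 0 [enc_tm s; enc_tm t]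
  | Lt s t => scott 9 1 [enc_tm s; enc_tm t]
  | Pr q t => scott 9 2 [enc q; enc_tm t]
  | Bot => scott 9 3 []
  | And A B => scott 9 4 [enc_fm enc A; enc_fm enc B]
  | Or A B => scott 9 5 [enc_fm enc A; enc_fm enc B]
  | Imp A B => scott 9 6 [enc_fm enc A; enc_fm enc B]
  | All A => scott 9 7 [enc_fm enc A]
  | Ex A => scott 9 8 [enc_fm enc A]
  end.

Definition enc_upc (q : upc) : lam :=
  match q with U => scott 3 0 [] | P => scott 3 1 [] | C => scott 3 2 [] end.

Definition enc_none (q : Empty_set) : lam := match q with end.

Definition effective (tr : fm upc -> fm Empty_set) : Prop :=
  exists s : lam, lfv s = 0 /\
    forall A, lred (LApp s (enc_fm enc_upc A)) (enc_fm enc_none (tr A)).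

(** Satisfaction is Tarskian and [Prop]-valued, [Eq] being interpreted by the
    identity of the domain; classical reasoning is left to the metalogic. *)
Record structure (Q : Type) : Type := {
  dom : Type;
  i_zero : dom;
  i_one : dom;
  i_add : dom -> dom -> dom;
  i_mul : dom -> dom -> dom;
  i_lt : dom -> dom -> Prop;
  i_pr : Q -> dom -> Prop }.

Fixpoint eval Q (M : structure Q) (e : nat -> dom M) (t : tm) : dom M :=
  match t with
  | Var n => e n
  | Zero => i_zero M
  | One => i_one M
  | Add s t => i_add (eval e s) (eval e t)
  | Mul s t => i_mul (eval e s) (eval e t)
  end.

Definition scons D (d : D) (e : nat -> D) (n : nat) : D :=
  match n with 0 => d | S k => e k end.

Fixpoint sat Q (M : structure Q) (e : nat -> dom M) (A : fm Q) : Prop :=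
  match A with
  | Eq s t => eval e s = eval e t
  | Lt s t => i_lt (eval e s) (eval e t)
  | Pr q t => i_pr q (eval e t)
  | Bot => False
  | And A B => sat e A /\ sat e B
  | Or A B => sat e A \/ sat e B
  | Imp A B => sat e A -> sat e B
  | All A => forall d, sat (scons d e) A
  | Ex A => exists d, sat (scons d e) A
  end.

Definition models Q (M : structure Q) (T : fm Q -> Prop) : Prop :=
  forall A, T A -> forall e : nat -> dom M, sat e A.

Definition expand (M : structure Empty_set) (I : upc -> dom M -> Prop) :
    structure upc :=
  {| dom := dom M; i_zero := i_zero M; i_one := i_one M;
     i_add := @i_add _ M; i_mul := @i_mul _ M; i_lt := @i_lt _ M;
     i_pr := I |}.

(* Main.v *)
Require Import Defs.
From Stdlib Require Import List Lia PeanoNat.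
From Stdlib Require Import FunctionalExtensionality PropExtensionality.
Import ListNotations.
Set Implicit Arguments.
Unset Strict Implicit.

(** Unfolding the defining clauses maps formulas to arithmetical formulas and
    commutes with the connectives, the quantifiers and substitution, because
    [definiens q t] is a schema that commutes with substitution in [t].

    The equivalence [A <-> A°] follows by induction on [A]: the clauses
    [Theta], instantiated at [t], give the atomic case, and provable
    equivalence is a congruence for every connective ([nd_iff_unfold]).

    For conservativity, a map of formulas that respects logical structure and
    substitution carries natural deductions to natural deductions as soon as it
    carries axioms to theorems ([nd_translate]).  The embedding [emb] is such a
    map from HA to the local theory.  Unfolding is one in the other direction:
    it fixes the axioms of HA and turns a defining clause into a trivial
    equivalence [D <-> D].  Since unfolding is the identity on arithmetical
    formulas, a proof of [emb phi] in the local theory becomes a proof of [phi]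
    in HA.

    The expansion of a model is forced: the clauses say which elements satisfy
    each new predicate, and the right-hand sides only speak of the arithmetical
    part.

    For effectiveness, the recursion equations of unfolding, and those of the
    lifting of terms used by [definiens], are programmed with a fixed-point
    combinator.  A Scott code applied to one branch per constructor selects its
    branch and passes it the arguments ([lred_cases]), so every program mirrors
    its recursion equations.  All terms that are ever substituted are closed,
    hence unaffected by later substitutions. *)

(** * Substitution in formulas *)

Lemma tsubst_ext f g t : (forall n, f n = g n) -> tsubst f t = tsubst g t.
Proof. intros H; induction t; simpl; congruence. Qed.

Lemma tsubst_comp f g t :
  tsubst g (tsubst f t) = tsubst (fun n => tsubst g (f n)) t.
Proof. induction t; simpl; congruence. Qed.

Lemma tsubst_Var t : tsubst Var t = t.
Proof. induction t; simpl; congruence. Qed.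

Lemma tsubst_up_lift f t : tsubst (up f) (lift t) = lift (tsubst f t).
Proof. unfold lift; rewrite !tsubst_comp; now apply tsubst_ext. Qed.

Lemma subst_ext Q (A : fm Q) : forall f g,
  (forall n, f n = g n) -> subst f A = subst g A.
Proof.
  induction A; simpl; intros f g H; f_equal; auto using tsubst_ext.
  all: apply IHA; intros [|n]; simpl; congruence.
Qed.

Lemma subst_comp Q (A : fm Q) : forall f g,
  subst g (subst f A) = subst (fun n => tsubst g (f n)) A.
Proof.
  induction A; simpl; intros f g; f_equal; auto using tsubst_comp.
  all: rewrite IHA; apply subst_ext; intros [|n]; simpl;
    auto using tsubst_up_lift.
Qed.

Lemma subst_Var Q (A : fm Q) : forall f, (forall n, f n = Var n) -> subst f A = A.
Proof.
  induction A; simpl; intros f H; f_equal; auto.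
  1-5: rewrite <- tsubst_Var; now apply tsubst_ext.
  all: apply IHA; intros [|n]; simpl; [|rewrite H]; reflexivity.
Qed.

(** Under a binder, a quantified formula lifted into the new context is
    instantiated at the bound variable itself. *)
Lemma inst_Var0_lift Q (A : fm Q) : inst (Var 0) (subst (up shift) A) = A.
Proof.
  unfold inst; rewrite subst_comp; apply subst_Var; now intros [|n].
Qed.

Lemma subst_definiens Q f q t :
  subst f (definiens q t : fm Q) = definiens q (tsubst f t).
Proof.
  destruct q; cbn; unfold AllLe, ExLe, Le, R, Neg; cbn;
    now rewrite ?tsubst_up_lift.
Qed.

Lemma emb_definiens Q q t : emb (definiens q t) = definiens q t :> fm Q.
Proof. now destruct q. Qed.

Lemma emb_subst Q (A : fm Empty_set) : forall f,
  emb (subst f A) = subst f (emb A) :> fm Q.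
Proof. induction A; intros f; simpl; try destruct q; f_equal; auto. Qed.

(** * Unfolding the definitions *)

Fixpoint unfold_defs (A : fm upc) : fm Empty_set :=
  match A with
  | Eq s t => Eq s t
  | Lt s t => Lt s t
  | Pr q t => definiens q t
  | Bot => Bot
  | And A B => And (unfold_defs A) (unfold_defs B)
  | Or A B => Or (unfold_defs A) (unfold_defs B)
  | Imp A B => Imp (unfold_defs A) (unfold_defs B)
  | All A => All (unfold_defs A)
  | Ex A => Ex (unfold_defs A)
  end.

Lemma unfold_subst A : forall f,
  unfold_defs (subst f A) = subst f (unfold_defs A).
Proof.
  induction A; intros f; simpl; try (f_equal; auto; fail).
  symmetry; apply subst_definiens.
Qed.

Lemma unfold_emb A : unfold_defs (emb A) = A.
Proof. induction A; simpl; try destruct q; congruence. Qed.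

(** * Provable equivalence is a congruence *)

Section Congruence.
Variables (Q : Type) (T : fm Q -> Prop).

(** Quantifying over the context makes weakening unnecessary: the congruence
    rules below use their premises in extended and in lifted contexts. *)
Definition entails (A B : fm Q) : Prop := forall G, nd T G (Imp A B).

Lemma nd_mp_in G A B : entails A B -> nd T G A -> nd T G B.
Proof. intros H; exact (nd_impE (H G)). Qed.

Lemma entails_intro A B : (forall G, nd T (A :: G) B) -> entails A B.
Proof. intros H G; apply nd_impI, H. Qed.

Lemma nd_head G A : nd T (A :: G) A.
Proof. apply nd_hyp; now left. Qed.

Lemma entails_refl A : entails A A.
Proof. apply entails_intro; intros; apply nd_head. Qed.

Lemma entails_And A A' B B' :
  entails A A' -> entails B B' -> entails (And A B) (And A' B').
Proof.
  intros HA HB; apply entails_intro; intros G; apply nd_andI.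
  - apply (nd_mp_in HA), (nd_andE1 (nd_head _ _)).
  - apply (nd_mp_in HB), (nd_andE2 (nd_head _ _)).
Qed.

Lemma entails_Or A A' B B' :
  entails A A' -> entails B B' -> entails (Or A B) (Or A' B').
Proof.
  intros HA HB; apply entails_intro; intros G.
  apply (nd_orE (nd_head _ _)).
  - apply nd_orI1, (nd_mp_in HA), nd_head.
  - apply nd_orI2, (nd_mp_in HB), nd_head.
Qed.

Lemma entails_Imp A A' B B' :
  entails A' A -> entails B B' -> entails (Imp A B) (Imp A' B').
Proof.
  intros HA HB; apply entails_intro; intros G; apply nd_impI.
  apply (nd_mp_in HB); apply nd_impE with A.
  - apply nd_hyp; simpl; auto.
  - apply (nd_mp_in HA), nd_head.
Qed.

Lemma entails_All A B : entails A B -> entails (All A) (All B).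
Proof.
  intros H; apply entails_intro; intros G; apply nd_allI, (nd_mp_in H).
  rewrite <- (inst_Var0_lift A) at 2; apply nd_allE, nd_head.
Qed.

Lemma entails_Ex A B : entails A B -> entails (Ex A) (Ex B).
Proof.
  intros H; apply entails_intro; intros G.
  apply (nd_exE (nd_head _ _)); apply nd_exI with (Var 0).
  fold (@subst Q); rewrite inst_Var0_lift; apply (nd_mp_in H), nd_head.
Qed.

End Congruence.

Lemma entails_definiens q t :
  entails T_loc (Pr q t) (definiens q t) /\
  entails T_loc (definiens q t) (Pr q t).
Proof.
  assert (H : forall G, nd T_loc G (Iff (Pr q t) (definiens q t))).
  { intros G.
    assert (E : Iff (Pr q t) (definiens q t)
                = inst t (Iff (Pr q (Var 0)) (definiens q (Var 0)))).
    { unfold inst, Iff; cbn [subst]; now rewrite !subst_definiens. }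
    rewrite E; apply nd_allE, nd_ax; right; now exists q. }
  split; intros G; [apply (nd_andE1 (H G)) | apply (nd_andE2 (H G))].
Qed.

(** Both directions are proved together because implication is contravariant
    on the left. *)
Lemma entails_unfold A :
  entails T_loc A (emb (unfold_defs A)) /\
  entails T_loc (emb (unfold_defs A)) A.
Proof.
  induction A; simpl; try (split; apply entails_refl).
  - rewrite emb_definiens; apply entails_definiens.
  - split; apply entails_And; tauto.
  - split; apply entails_Or; tauto.
  - split; apply entails_Imp; tauto.
  - split; apply entails_All; tauto.
  - split; apply entails_Ex; tauto.
Qed.

Lemma nd_iff_unfold G A : nd T_loc G (Iff A (emb (unfold_defs A))).
Proof.
  destruct (entails_unfold A) as [H1 H2]; apply nd_andI; [apply H1 | apply H2].
Qed.

(** * Translating derivations *)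

(** The image of [Pr] is left open: this is what lets [unfold_defs] be an
    instance. *)
Record logical_map Q Q' (h : fm Q -> fm Q') : Prop := {
  lm_eq : forall s t, h (Eq s t) = Eq s t;
  lm_bot : h Bot = Bot;
  lm_and : forall A B, h (And A B) = And (h A) (h B);
  lm_or : forall A B, h (Or A B) = Or (h A) (h B);
  lm_imp : forall A B, h (Imp A B) = Imp (h A) (h B);
  lm_all : forall A, h (All A) = All (h A);
  lm_ex : forall A, h (Ex A) = Ex (h A);
  lm_subst : forall f A, h (subst f A) = subst f (h A) }.

(** Commuting with lifting is what preserves the eigenvariable conditions, and
    commuting with instantiation what preserves the other quantifier rules and
    the replacement of equals. *)
Lemma nd_translate Q Q' (T : fm Q -> Prop) (T' : fm Q' -> Prop) h :
  logical_map h -> (forall A, T A -> forall G, nd T' G (h A)) ->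
  forall G A, nd T G A -> nd T' (map h G) (h A).
Proof.
  intros L HT G A D.
  assert (S : forall f G, map h (map (subst f) G) = map (subst f) (map h G)).
  { intros f G'; rewrite !map_map; apply map_ext; intros; apply (lm_subst L). }
  induction D; cbn [map] in *; unfold inst in *;
    rewrite ?S, ?(lm_bot L), ?(lm_and L), ?(lm_or L),
      ?(lm_imp L), ?(lm_all L), ?(lm_ex L), ?(lm_eq L),
      ?(lm_subst L) in *.
  - now apply HT.
  - now apply nd_hyp, in_map.
  - now apply nd_botE.
  - now apply nd_andI.
  - eapply nd_andE1; eauto.
  - eapply nd_andE2; eauto.
  - now apply nd_orI1.
  - now apply nd_orI2.
  - eapply nd_orE; eauto.
  - now apply nd_impI.
  - eapply nd_impE; eauto.
  - now apply nd_allI.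
  - now apply nd_allE.
  - now apply nd_exI with t.
  - eapply nd_exE; eauto.
  - apply nd_eqI.
  - now apply nd_eqE with s.
Qed.

Lemma logical_map_emb Q : logical_map (@emb Q).
Proof. split; try reflexivity; intros; apply emb_subst. Qed.

Lemma logical_map_unfold : logical_map unfold_defs.
Proof. split; try reflexivity; intros; apply unfold_subst. Qed.

Lemma conservative phi : proves T_loc (emb phi) <-> proves HA phi.
Proof.
  split; intros D.
  - rewrite <- (unfold_emb phi).
    apply (nd_translate (T' := HA) logical_map_unfold) in D; [exact D|].
    intros A [(B & HB & ->) | (q & ->)] G.
    + rewrite unfold_emb; now apply nd_ax.
    (* The clause for [q] has become [definiens <-> definiens]. *)
    + destruct q; apply nd_allI, nd_andI; apply entails_refl.
  - apply (nd_translate (T' := T_loc) (logical_map_emb upc)) in D; [exact D|].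
    intros A HA' G; apply nd_ax; left; now exists A.
Qed.

(** * Expansion of models *)

(** [Var 0] is the only free variable of [definiens q (Var 0)], which is
    arithmetical, so its truth value depends on neither the assignment nor the expansion. *)
Lemma sat_expand_definiens M I q d e :
  sat (M := expand I) (scons d e) (definiens q (Var 0)) =
  sat (M := M) (scons d (fun _ => d)) (definiens q (Var 0)).
Proof. now destruct q. Qed.

Lemma unique_expansion M :
  exists! I : upc -> dom M -> Prop, models (expand I) Theta.
Proof.
  exists (fun q d => sat (M := M) (scons d (fun _ => d)) (definiens q (Var 0))).
  split.
  - intros A [q ->] e d; cbn [sat Iff].
    rewrite sat_expand_definiens; cbn; tauto.
  - intros I HI.
    apply functional_extensionality; intros q.
    apply functional_extensionality; intros d.
    apply propositional_extensionality.
    assert (H : sat (M := expand I) (fun _ => d)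
                  (All (Iff (Pr q (Var 0)) (definiens q (Var 0))))).
    { apply HI; now exists q. }
    specialize (H d); cbn [sat Iff] in H.
    rewrite sat_expand_definiens in H; cbn in H; tauto.
Qed.

(** * Reduction of closed lambda terms *)

Lemma lrename_id s : forall n r, lfv s <= n -> (forall i, i < n -> r i = i) ->
  lrename r s = s.
Proof.
  induction s as [m|s IHs t IHt|s IH]; simpl; intros n r Hn Hr; f_equal.
  - apply Hr; lia.
  - apply IHs with n; auto; lia.
  - apply IHt with n; auto; lia.
  - apply IH with (S n); [lia|].
    intros [|i] Hi; [|rewrite Hr by lia]; reflexivity.
Qed.

Lemma lsubst_id s : forall n f, lfv s <= n -> (forall i, i < n -> f i = LVar i) ->
  lsubst f s = s.
Proof.
  induction s as [m|s IHs t IHt|s IH]; simpl; intros n f Hn Hf.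
  - apply Hf; lia.
  - rewrite (IHs n), (IHt n); auto; lia.
  - f_equal; apply IH with (S n); [lia|].
    intros [|i] Hi; [|rewrite Hf by lia]; reflexivity.
Qed.

Definition closed (s : lam) : Prop := lfv s = 0.

Lemma lrename_closed r s : closed s -> lrename r s = s.
Proof. intros H; apply lrename_id with 0; [rewrite H|]; lia. Qed.

Lemma lsubst_closed f s : closed s -> lsubst f s = s.
Proof. intros H; apply lsubst_id with 0; [rewrite H|]; lia. Qed.

(** [n] binders over the head [h] applied to [args]: a Scott code whose head
    variable may already have been replaced by a branch. *)
Definition code (n : nat) (h : lam) (args : list lam) : lam :=
  Nat.iter n LLam (fold_left LApp args h).

Fixpoint upn (n : nat) (f : nat -> lam) : nat -> lam :=
  match n with
  | 0 => f
  | S n => upn n (fun i => match i with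
                           | 0 => LVar 0
                           | S k => lrename S (f k)
                           end)
  end.

Lemma lsubst_iter n : forall f b,
  lsubst f (Nat.iter n LLam b) = Nat.iter n LLam (lsubst (upn n f) b).
Proof.
  induction n as [|n IH]; intros f b; [reflexivity|].
  simpl; f_equal; apply IH.
Qed.

Lemma lsubst_apps f args : forall h, Forall closed args ->
  lsubst f (fold_left LApp args h) = fold_left LApp args (lsubst f h).
Proof.
  induction args as [|a args IH]; intros h H; [reflexivity|].
  inversion H; subst; simpl; rewrite IH by assumption; simpl.
  now rewrite (@lsubst_closed f a).
Qed.

Definition single (c : lam) (n : nat) : lam :=
  match n with 0 => c | S k => LVar k end.

(** The invariant behind [upn n (single c)] passing binders: it fixes the
    indices below [n] and puts [c] at [n]. *)
Lemma upn_spec n : forall m f c, closed c ->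
  (forall i, i < m -> f i = LVar i) -> f m = c ->
  (forall i, i < n + m -> upn n f i = LVar i) /\ upn n f (n + m) = c.
Proof.
  induction n as [|n IH]; intros m f c Hc Hlt Hm; [now split|].
  replace (S n + m) with (n + S m) by lia; apply IH; trivial.
  - intros [|i] Hi; [|rewrite Hlt by lia]; reflexivity.
  - now rewrite Hm, lrename_closed.
Qed.

Lemma lred_iter n b c :
  lred (LApp (Nat.iter (S n) LLam b) c)
       (Nat.iter n LLam (lsubst (upn n (single c)) b)).
Proof. rewrite <- lsubst_iter; apply lred_beta. Qed.

Lemma lred_code n h c args : Forall closed args ->
  lred (LApp (code (S n) h args) c)
       (code n (lsubst (upn n (single c)) h) args).
Proof.
  intros Ha; unfold code; rewrite <- lsubst_apps by assumption.
  apply lred_iter.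
Qed.

Lemma upn_single_lt n c i : closed c -> i < n -> upn n (single c) i = LVar i.
Proof.
  intros Hc Hi; apply (@upn_spec n 0 (single c) c); trivial; lia.
Qed.

Lemma upn_single_eq n c : closed c -> upn n (single c) n = c.
Proof.
  intros Hc; destruct (@upn_spec n 0 (single c) c) as [_ E]; trivial; [lia|].
  now rewrite Nat.add_0_r in E.
Qed.

Lemma lred_appl s s' t : lred s s' -> lred (LApp s t) (LApp s' t).
Proof. intros H; apply lred_app; [exact H | apply lred_refl]. Qed.

(** The branches are listed in the order of the constructors.  The first
    argument of a Scott code instantiates its outermost binder, which belongs to
    the last constructor. *)
Definition cases (x : lam) (cs : list lam) : lam :=
  fold_right (fun c s => LApp s c) x cs.

(** General form in which [n] binders outlast the branches; [lred_cases] is the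
    case [n = 0].  An index [i >= n] is met at the branch for which exactly [i]
    binders remain, and the other branches are discarded. *)
Lemma lred_cases_code cs : forall n i args,
  i < n + length cs -> Forall closed cs -> Forall closed args ->
  lred (cases (code (length cs + n) (LVar i) args) cs)
       (code n (if i <? n then LVar i else nth (i - n) cs (LVar 0)) args).
Proof.
  induction cs as [|c cs IH]; intros n i args Hi Hcs Ha; simpl in *.
  - destruct (Nat.ltb_spec i n); [apply lred_refl | lia].
  - inversion Hcs; subst.
    eapply lred_trans; [apply lred_appl|].
    + change (LLam (code ?k ?h args)) with (code (S k) h args).
      replace (S (length cs + n)) with (length cs + S n) by lia.
      apply IH; trivial; lia.
    + eapply lred_trans; [now apply lred_code|].
      destruct (Nat.ltb_spec i (S n)); destruct (Nat.ltb_spec i n); try lia;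
        cbn [lsubst].
      * rewrite upn_single_lt by assumption; apply lred_refl.
      * replace i with n by lia; rewrite Nat.sub_diag, upn_single_eq by assumption.
        apply lred_refl.
      * replace (i - n) with (S (i - S n)) by lia; simpl.
        rewrite lsubst_closed; [apply lred_refl|].
        apply Forall_nth; trivial; lia.
Qed.

Lemma lred_cases cs i args :
  i < length cs -> Forall closed cs -> Forall closed args ->
  lred (cases (scott (length cs) i args) cs)
       (fold_left LApp args (nth i cs (LVar 0))).
Proof.
  intros Hi Hcs Ha.
  pose proof (@lred_cases_code cs 0 i args Hi Hcs Ha) as H.
  now rewrite Nat.add_0_r, Nat.sub_0_r in H.
Qed.

(** * Programs on codes *)

Lemma closed_scott n i args :
  i < n -> Forall closed args -> closed (scott n i args).
Proof.
  intros Hi Ha.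
  assert (HL : forall b, lfv (Nat.iter n LLam b) = lfv b - n).
  { clear; induction n as [|n IH]; intros b; simpl; [|rewrite IH]; lia. }
  assert (HA : forall h, lfv (fold_left LApp args h) = lfv h).
  { clear Hi; induction Ha as [|a args E _ IH]; intros h; [reflexivity|].
    simpl; rewrite IH; simpl; rewrite E; apply Nat.max_0_r. }
  unfold closed, scott; rewrite HL, HA; cbn [lfv]; lia.
Qed.

Ltac closed :=
  repeat first [reflexivity | assumption | lia | apply Forall_nil
               | apply Forall_cons | apply closed_scott].

Lemma closed_enc_nat n : closed (enc_nat n).
Proof. induction n; cbn [enc_nat]; closed. Qed.

Lemma closed_enc_tm t : closed (enc_tm t).
Proof. induction t; cbn [enc_tm]; closed; apply closed_enc_nat. Qed.

Lemma closed_enc_fm Q (enc : Q -> lam) A :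
  (forall q, closed (enc q)) -> closed (enc_fm enc A).
Proof.
  intros H; induction A; cbn [enc_fm]; closed; trivial; apply closed_enc_tm.
Qed.

Lemma closed_enc_upc q : closed (enc_upc q).
Proof. destruct q; reflexivity. Qed.

Lemma closed_enc_none q : closed (enc_none q).
Proof. destruct q. Qed.

Ltac closed ::=
  repeat first [reflexivity | assumption | lia | apply Forall_nil
               | apply Forall_cons | apply closed_enc_nat | apply closed_enc_tm
               | apply closed_enc_fm; first [exact closed_enc_upc | exact closed_enc_none]
               | apply closed_enc_upc | apply closed_scott].

(** The constructors as closed functions.  A program is then built by
    application from closed constants, and no code is ever rebuilt under a
    binder. *)
Definition con1 (n i : nat) : lam :=
  LLam (Nat.iter n LLam (LApp (LVar i) (LVar n))).
Definition con2 (n i : nat) : lam :=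
  LLam (LLam (Nat.iter n LLam (LApp (LApp (LVar i) (LVar (S n))) (LVar n)))).

Definition app2 (c x y : lam) : lam := LApp (LApp c x) y.

Lemma lred_con1 n i x a : i < n -> closed a -> lred x a ->
  lred (LApp (con1 n i) x) (scott n i [a]).
Proof.
  intros Hi Ha Hx; eapply lred_trans; [apply lred_app, Hx; apply lred_refl|].
  eapply lred_trans; [apply lred_iter|]; cbn [lsubst].
  rewrite upn_single_lt, upn_single_eq by assumption; apply lred_refl.
Qed.

Lemma lred_con2 n i x y a b : i < n -> closed a -> closed b ->
  lred x a -> lred y b -> lred (app2 (con2 n i) x y) (scott n i [a; b]).
Proof.
  intros Hi Ha Hb Hx Hy; unfold app2, con2.
  eapply lred_trans; [apply lred_app, Hy; apply lred_app, Hx; apply lred_refl|].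
  eapply lred_trans; [apply lred_appl, (@lred_iter (S n))|]; cbn [lsubst].
  rewrite (@upn_single_lt _ _ i), (@upn_single_lt _ _ n), upn_single_eq
    by (trivial; lia).
  eapply lred_trans; [apply lred_iter|]; cbn [lsubst].
  rewrite upn_single_lt, upn_single_eq, lsubst_closed by assumption.
  apply lred_refl.
Qed.

Lemma lsubst_cases f x cs :
  lsubst f (cases x cs) = cases (lsubst f x) (map (lsubst f) cs).
Proof. induction cs; simpl; congruence. Qed.

Lemma map_lsubst_closed f cs : Forall closed cs -> map (lsubst f) cs = cs.
Proof.
  induction 1; simpl; [reflexivity|]; rewrite lsubst_closed; congruence.
Qed.

Lemma lfv_cases x cs : Forall closed cs -> lfv (cases x cs) = lfv x.
Proof.
  induction 1 as [|c cs E _ IH]; simpl; [|rewrite IH, E]; lia.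
Qed.

Definition fixpoint (b : lam) : lam :=
  LApp (LLam (LApp b (LApp (LVar 0) (LVar 0))))
       (LLam (LApp b (LApp (LVar 0) (LVar 0)))).

Lemma lred_fixpoint b : closed b -> lred (fixpoint b) (LApp b (fixpoint b)).
Proof.
  intros H; eapply lred_trans; [apply lred_beta|].
  cbn [lsubst]; rewrite lsubst_closed by assumption; apply lred_refl.
Qed.

(** Recursion on a code.  Each branch receives the arguments of its constructor
    and, last, the recursive function itself; this way the branches are
    closed. *)
Definition recursion (bs : list lam) : lam :=
  fixpoint (LLam (LLam (LApp (cases (LVar 0) bs) (LVar 1)))).

Lemma closed_recursion bs : Forall closed bs -> closed (recursion bs).
Proof.
  intros H; unfold closed, recursion, fixpoint; simpl.
  now rewrite lfv_cases.
Qed.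

Lemma lred_recursion bs n i args :
  length bs = n -> i < n -> Forall closed bs -> Forall closed args ->
  lred (LApp (recursion bs) (scott n i args))
       (fold_left LApp (args ++ [recursion bs]) (nth i bs (LVar 0))).
Proof.
  intros <- Hi Hbs Ha.
  pose proof (closed_recursion Hbs) as Hr.
  eapply lred_trans; [apply lred_appl, lred_fixpoint|].
  { unfold closed; simpl; now rewrite lfv_cases. }
  fold (recursion bs).
  eapply lred_trans; [apply lred_appl, lred_beta|].
  cbn [lsubst]; rewrite lsubst_cases, map_lsubst_closed, lrename_closed
    by assumption.
  eapply lred_trans; [apply lred_beta|].
  cbn [lsubst]; rewrite lsubst_cases, map_lsubst_closed, (lsubst_closed _ Hr)
    by assumption.
  rewrite fold_left_app; apply lred_appl; cbn [lsubst].
  now apply lred_cases.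
Qed.

Ltac beta_head :=
  lazymatch goal with
  | |- lred (LApp (LLam _) _) _ => apply lred_beta
  | |- lred (LApp (LApp _ _) _) _ => apply lred_appl; beta_head
  end.

(* Substitution is to be simplified on closed subterms only; the others become
   closed after further reductions. *)
Ltac simpl_closed :=
  repeat match goal with
  | |- context [lrename ?r ?s] => rewrite (@lrename_closed r s) by closed
  | |- context [lsubst ?f ?s] => rewrite (@lsubst_closed f s) by closed
  end.

Ltac beta :=
  eapply lred_trans; [beta_head|]; cbn [lsubst lrename app2]; simpl_closed.

(** Branches that rebuild a constructor, from its arguments or from their images
    under the recursive function. *)
Definition keep0 (n i : nat) : lam := LLam (scott n i []).
Definition keep2 (n i : nat) : lam :=
  LLam (LLam (LLam (app2 (con2 n i) (LVar 2) (LVar 1)))).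
Definition map1 (n i : nat) : lam :=
  LLam (LLam (LApp (con1 n i) (LApp (LVar 0) (LVar 1)))).
Definition map2 (n i : nat) : lam :=
  LLam (LLam (LLam (app2 (con2 n i) (LApp (LVar 0) (LVar 2))
                                    (LApp (LVar 0) (LVar 1))))).

Definition lift_prog : lam :=
  recursion
    [LLam (LLam (LApp (con1 5 0) (LApp (con1 2 1) (LVar 1))));
     keep0 5 1; keep0 5 2; map2 5 3; map2 5 4].

Lemma lred_lift t : lred (LApp lift_prog (enc_tm t)) (enc_tm (lift t)).
Proof.
  induction t; cbn [enc_tm].
  all: eapply lred_trans; [apply lred_recursion; closed|]; cbn [app fold_left nth].
  all: fold lift_prog; unfold keep0, map2; repeat beta.
  - cbn [lift tsubst shift enc_tm enc_nat].
    apply lred_con1; closed; apply lred_con1; closed; apply lred_refl.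
  - apply lred_refl.
  - apply lred_refl.
  - now apply (@lred_con2 5 3 _ _ (enc_tm (lift t1)) (enc_tm (lift t2))); closed.
  - now apply (@lred_con2 5 4 _ _ (enc_tm (lift t1)) (enc_tm (lift t2))); closed.
Qed.

(** Functions on lambda terms rather than lambda terms: the same expression then
    serves as the body of a program, at a variable, and as its value, at the code
    of a term. *)
Definition le_code (x : lam) : lam :=
  app2 (con2 9 5) (app2 (con2 9 1) (enc_tm (Var 0)) x)
                  (app2 (con2 9 0) (enc_tm (Var 0)) x).

Definition R_code (x : lam) : lam :=
  app2 (con2 9 4) (enc_fm enc_none (Lt One (Var 1)))
    (app2 (con2 9 4) (enc_fm enc_none (Lt One (Var 0)))
       (app2 (con2 9 0) (enc_tm (Mul (Var 1) (Var 0))) x)).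

Definition neg_code (x : lam) : lam :=
  app2 (con2 9 6) x (enc_fm enc_none Bot).

Definition all_le_code (x y : lam) : lam :=
  LApp (con1 9 7) (app2 (con2 9 6) (le_code (LApp lift_prog x)) y).

Definition ex_le_code (x y : lam) : lam :=
  LApp (con1 9 8) (app2 (con2 9 4) (le_code (LApp lift_prog x)) y).

Definition definiens_code (q : upc) (x : lam) : lam :=
  let x1 := LApp lift_prog x in
  let x2 := LApp lift_prog x1 in
  match q with
  | U => app2 (con2 9 0) x (enc_tm One)
  | P => app2 (con2 9 4) (app2 (con2 9 1) (enc_tm One) x)
           (all_le_code x (all_le_code x1 (neg_code (R_code x2))))
  | C => ex_le_code x (ex_le_code x1 (R_code x2))
  end.

Lemma lred_definiens q t :
  lred (definiens_code q (enc_tm t)) (enc_fm enc_none (definiens q t)).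
Proof.
  pose proof (lred_lift t) as H1.
  pose proof (lred_trans (lred_app (lred_refl lift_prog) H1) (lred_lift (lift t)))
    as H2.
  destruct q; unfold definiens_code, all_le_code, ex_le_code, neg_code, R_code,
    le_code, definiens, AllLe, ExLe, Le, Neg, R; cbn [enc_fm].
  all: repeat first [assumption | apply lred_con2; closed | apply lred_con1; closed
                    | apply lred_refl].
Qed.

Definition definiens_prog (q : upc) : lam := LLam (definiens_code q (LVar 0)).

Lemma lred_definiens_prog q t :
  lred (LApp (definiens_prog q) (enc_tm t)) (enc_fm enc_none (definiens q t)).
Proof.
  eapply lred_trans; [apply lred_beta|].
  replace (lsubst _ _) with (definiens_code q (enc_tm t));
    [apply lred_definiens|].
  destruct q; unfold definiens_code, all_le_code, ex_le_code, neg_code, R_code,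
    le_code, app2; cbn [lsubst];
    simpl_closed; reflexivity.
Qed.

Definition unfold_prog : lam :=
  recursion
    [keep2 9 0; keep2 9 1;
     LLam (LLam (LLam
       (LApp (cases (LVar 2)
                [definiens_prog U; definiens_prog P; definiens_prog C])
             (LVar 1))));
     keep0 9 3; map2 9 4; map2 9 5; map2 9 6; map1 9 7; map1 9 8].

Lemma lred_unfold A :
  lred (LApp unfold_prog (enc_fm enc_upc A)) (enc_fm enc_none (unfold_defs A)).
Proof.
  induction A; cbn [enc_fm unfold_defs].
  all: eapply lred_trans; [apply lred_recursion; closed|]; cbn [app fold_left nth].
  all: fold unfold_prog; unfold keep0, keep2, map1, map2; repeat beta.
  all: try (first [apply lred_con2 | apply lred_con1]; closed; apply lred_refl).
  2: apply lred_refl.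
  rewrite !lsubst_cases, !map_lsubst_closed by closed.
  cbn [lsubst lrename]; simpl_closed.
  eapply lred_trans; [apply lred_appl|apply lred_definiens_prog].
  destruct q;
    [ apply (@lred_cases (map definiens_prog [U; P; C]) 0 [])
    | apply (@lred_cases (map definiens_prog [U; P; C]) 1 [])
    | apply (@lred_cases (map definiens_prog [U; P; C]) 2 []) ];
    cbn [map length]; closed.
Qed.

Theorem theorem6p1p2 :
  (exists tr : fm upc -> fm Empty_set,
      replaces_definitions tr /\
      effective tr /\
      (forall A : fm upc, proves T_loc (Iff A (emb (tr A))))) /\
  (forall phi : fm Empty_set,
      sentence phi -> (proves T_loc (emb phi) <-> proves HA phi)) /\
  (forall M : structure Empty_set,
      models M HA ->
      exists! I : upc -> dom M -> Prop, models (expand I) Theta).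
Proof.
  repeat split.
  - exists unfold_defs; repeat split.
    + exists unfold_prog; split; [reflexivity | exact lred_unfold].
    + intros A; apply nd_iff_unfold.
  - apply conservative.
  - apply conservative.
  - intros M _; apply unique_expansion.
Qed.
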